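(* Let $G$ be a non-trivial finitely generated group and let $H$ be a group that is not finitely generated (of arbitrary cardinality). Assume there exists a group that is IG and finitely generated, and let $A$ be such a group. Then: (1) $G\wr\mathbb{Z}$ is FIG; (2) $G\wr(A\times\mathbb{Z})$ is IG and finitely generated, and moreover $G\wr A$ is IG and finitely generated if $A$ is not torsion; (3) $H\wr\mathbb{Z}$ is IG. Hence every finitely generated group embeds into a FIG group and every group embeds into an IG group. Should a group exist that is IG and finitely generated, then every finitely generated group embeds into a finitely generated IG group.
   Context: A subset $S$ of a group $K$ invariably generates $K$ if for every choice of elements $a_s\in K$ ($s\in S$) one has $\langle a_s^{-1}sa_s : s\in S\rangle=K$. A group is FIG (finitely invariably generated) if it has a finite invariable generating set. A group is IG if it has an invariable generating set but no finite one (so IG excludes FIG). For non-trivial groups $P,Q$, the regular (restricted) wreath product is $P\wr Q=\left(\bigoplus_{q\in Q}P_q\right)\rtimes Q$, where each $P_q$ is a copy of $P$, $p^{(q)}$ denotes the element $p\in P$ in $P_q$, and $h^{-1}p^{(q)}h=p^{(qh)}$ for $h\in Q$. A group is torsion if all its elements have finite order. *)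

(* Defs.v *)
From HB Require Import structures.
From mathcomp Require Import all_boot all_order all_algebra finmap.
From mathcomp Require Import boolp classical_sets functions cardinality.

Set Implicit Arguments.
Unset Strict Implicit.
Unset Printing Implicit Defensive.

Local Open Scope classical_set_scope.
Local Open Scope group_scope.

(* [groupType] is MathComp's type of arbitrary, possibly infinite, groups.  The
   choiceType it asks of its carrier is no restriction under the classical
   axioms of boolp. *)

Definition is_subgroup (K : groupType) (A : set K) : Prop :=
  A 1 /\ forall x y, A x -> A y -> A (x / y).

Definition generated (K : groupType) (S : set K) : set K :=
  smallest (@is_subgroup K) S.

Definition finitely_generated (K : groupType) : Prop :=
  exists S : set K, finite_set S /\ generated S = setT.

(* Only the values of [a] on [S] matter; [s ^ a s] is [(a s)^-1 * s * a s]. *)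
Definition invariably_generates (K : groupType) (S : set K) : Prop :=
  forall a : K -> K, generated [set s ^ a s | s in S] = setT.

Definition FIG (K : groupType) : Prop :=
  exists S : set K, finite_set S /\ invariably_generates S.

Definition IG (K : groupType) : Prop :=
  (exists S : set K, invariably_generates S) /\ ~ FIG K.

Definition nontrivial (K : groupType) : Prop := exists x : K, x <> 1.

Definition torsion (K : groupType) : Prop :=
  forall x : K, exists n : nat, (0 < n)%N /\ x ^+ n = 1.

Definition embeds (K L : groupType) : Prop :=
  exists f : {multiplicative K -> L}, injective f.

(* The infinite cyclic group, written multiplicatively. *)
Definition infcyc : groupType := Algebra.to_multiplicative int.

(* The restricted direct sum of copies of [P] indexed by [Q]: finitely
   supported functions with the pointwise product. *)
Definition dsum (Q : choiceType) (P : groupType) : Type :=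
  {fsfun Q -> P with 1}.

HB.instance Definition _ (Q : choiceType) (P : groupType) :=
  Choice.copy (dsum Q P) {fsfun Q -> P with 1}.

Section DirectSum.
Context {Q : choiceType} {P : groupType}.
Implicit Types f g : dsum Q P.

Definition dsum_app f : Q -> P := fun_of_fsfun f.

Lemma dsumP f g : dsum_app f =1 dsum_app g -> f = g.
Proof. by move/fsfunP. Qed.

Definition dsum_one : dsum Q P := [fsfun with 1].

Definition dsum_mul f g : dsum Q P :=
  [fsfun x in (finsupp f `|` finsupp g)%fset => dsum_app f x * dsum_app g x].

Definition dsum_inv f : dsum Q P :=
  [fsfun x in finsupp f => (dsum_app f x)^-1].

Definition dsum_single (q : Q) (p : P) : dsum Q P :=
  [fsfun x in [fset q]%fset => p].

Lemma dsum_oneE x : dsum_app dsum_one x = 1.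
Proof. by rewrite /dsum_app fsfunE. Qed.

Lemma dsum_mulE f g x : dsum_app (dsum_mul f g) x = dsum_app f x * dsum_app g x.
Proof.
rewrite {1}/dsum_app fsfun_fun in_fsetU; case: ifP => // /norP.
by rewrite /dsum_app => -[/fsfun_dflt -> /fsfun_dflt ->]; rewrite mulg1.
Qed.

Lemma dsum_invE f x : dsum_app (dsum_inv f) x = (dsum_app f x)^-1.
Proof.
rewrite {1}/dsum_app fsfun_fun; case: ifPn => //.
by rewrite /dsum_app => /fsfun_dflt ->; rewrite invg1.
Qed.

Lemma dsum_singleE q p x :
  dsum_app (dsum_single q p) x = if x == q then p else 1.
Proof. by rewrite /dsum_app fsfun_fun in_fset1. Qed.

Lemma dsum_mulA : associative dsum_mul.
Proof. by move=> f g h; apply: dsumP => x; rewrite !dsum_mulE mulgA. Qed.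

Lemma dsum_mul1g : left_id dsum_one dsum_mul.
Proof. by move=> f; apply: dsumP => x; rewrite dsum_mulE dsum_oneE mul1g. Qed.

Lemma dsum_mulg1 : right_id dsum_one dsum_mul.
Proof. by move=> f; apply: dsumP => x; rewrite dsum_mulE dsum_oneE mulg1. Qed.

Lemma dsum_mulVg : left_inverse dsum_one dsum_inv dsum_mul.
Proof.
by move=> f; apply: dsumP => x; rewrite dsum_mulE dsum_invE dsum_oneE mulVg.
Qed.

Lemma dsum_mulgV : right_inverse dsum_one dsum_inv dsum_mul.
Proof.
by move=> f; apply: dsumP => x; rewrite dsum_mulE dsum_invE dsum_oneE mulgV.
Qed.

HB.instance Definition _ := isGroup.Build (dsum Q P)
  dsum_mulA dsum_mul1g dsum_mulg1 dsum_mulVg dsum_mulgV.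

End DirectSum.

(* The right action of [Q] on [dsum Q P] by translation: [dsum_shift f h] sends
   [x] to [f (x / h)], i.e. moves the coordinate at [q] to [q * h]. *)
Section Shift.
Context {Q P : groupType}.
Implicit Types (f g : dsum Q P) (h k : Q).

Definition dsum_shift f h : dsum Q P :=
  [fsfun x in [fset y * h | y in finsupp f]%fset => dsum_app f (x / h)].

Lemma dsum_shiftE f h x : dsum_app (dsum_shift f h) x = dsum_app f (x / h).
Proof.
rewrite {1}/dsum_app fsfun_fun; case: ifPn => // /negP xN.
rewrite /dsum_app fsfun_dflt //; apply/negP => xf; apply: xN.
by apply/imfsetP; exists (x / h) => //=; rewrite mulgVK.
Qed.

Lemma dsum_shift1 f : dsum_shift f 1 = f.
Proof. by apply: dsumP => x; rewrite dsum_shiftE divg1. Qed.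

Lemma dsum_shiftM f h k : dsum_shift (dsum_shift f h) k = dsum_shift f (h * k).
Proof. by apply: dsumP => x; rewrite !dsum_shiftE invgM mulgA. Qed.

Lemma dsum_shift_mul f g h :
  dsum_shift (f * g) h = dsum_shift f h * dsum_shift g h.
Proof.
by apply: dsumP => x; rewrite !(dsum_shiftE, dsum_mulE).
Qed.

Lemma dsum_shift_one h : dsum_shift (1 : dsum Q P) h = 1.
Proof. by apply: dsumP => x; rewrite dsum_shiftE !dsum_oneE. Qed.

Lemma dsum_shift_single q p h :
  dsum_shift (dsum_single q p) h = dsum_single (q * h) p.
Proof. by apply: dsumP => x; rewrite dsum_shiftE !dsum_singleE divg_eq. Qed.

End Shift.

(* The pair [Wreath f h] stands for the product [f h] with [f] in the base group
   and [h] in [Q], whence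
     (f h) (g k) = f (h g h^-1) h k    and    h g h^-1 = dsum_shift g h^-1. *)
Record wreath (P Q : groupType) : Type :=
  Wreath { wr_base : dsum Q P; wr_top : Q }.

Section WreathProduct.
Context {P Q : groupType}.
Implicit Types u v : wreath P Q.

Definition wreath_pair u : dsum Q P * Q := (wr_base u, wr_top u).
Definition pair_wreath (w : dsum Q P * Q) : wreath P Q := Wreath w.1 w.2.

Lemma wreath_pairK : cancel wreath_pair pair_wreath.
Proof. by case. Qed.

HB.instance Definition _ := Choice.copy (wreath P Q) (can_type wreath_pairK).

Definition wreath_one : wreath P Q := Wreath 1 1.

Definition wreath_mul u v : wreath P Q :=
  Wreath (wr_base u * dsum_shift (wr_base v) (wr_top u)^-1)
         (wr_top u * wr_top v).

Definition wreath_inv u : wreath P Q :=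
  Wreath (dsum_shift (wr_base u)^-1 (wr_top u)) (wr_top u)^-1.

Lemma wreath_mulA : associative wreath_mul.
Proof.
move=> [f h] [g k] [e l]; rewrite /wreath_mul /=.
by rewrite dsum_shift_mul dsum_shiftM invgM !mulgA.
Qed.

Lemma wreath_mul1g : left_id wreath_one wreath_mul.
Proof.
by move=> [f h]; rewrite /wreath_mul /= invg1 dsum_shift1 !mul1g.
Qed.

Lemma wreath_mulg1 : right_id wreath_one wreath_mul.
Proof. by move=> [f h]; rewrite /wreath_mul /= dsum_shift_one !mulg1. Qed.

Lemma wreath_mulVg : left_inverse wreath_one wreath_inv wreath_mul.
Proof.
move=> [f h]; rewrite /wreath_mul /= invgK -dsum_shift_mul !mulVg.
by rewrite dsum_shift_one.
Qed.

Lemma wreath_mulgV : right_inverse wreath_one wreath_inv wreath_mul.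
Proof.
by move=> [f h]; rewrite /wreath_mul /= dsum_shiftM !mulgV dsum_shift1 mulgV.
Qed.

HB.instance Definition _ := isGroup.Build (wreath P Q)
  wreath_mulA wreath_mul1g wreath_mulg1 wreath_mulVg wreath_mulgV.

Lemma wreath_mulE (f g : dsum Q P) (h k : Q) :
  (Wreath f h : wreath P Q) * Wreath g k
    = Wreath (f * dsum_shift g h^-1) (h * k).
Proof. by []. Qed.

Lemma wreath_invE (f : dsum Q P) (h : Q) :
  (Wreath f h : wreath P Q)^-1 = Wreath (dsum_shift f^-1 h) h^-1.
Proof. by []. Qed.

(* The relation h^-1 p^(q) h = p^(qh) that determines the action. *)
Lemma wreath_conj (p : P) (q h : Q) :
  (Wreath (dsum_single q p) 1 : wreath P Q) ^ Wreath 1 h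
    = Wreath (dsum_single (q * h) p) 1.
Proof.
rewrite conjgE wreath_invE !wreath_mulE invg1 invgK !dsum_shift_one.
by rewrite mulg1 !mul1g mulVg dsum_shift_single.
Qed.

End WreathProduct.

(* Main.v *)
Require Import Defs.
From HB Require Import structures.
From mathcomp Require Import all_boot all_order all_algebra finmap.
From mathcomp Require Import boolp classical_sets functions cardinality.

(** A set [S] invariably generates [K] exactly when the only subgroup meeting the
conjugacy class of every element of [S] is [K] itself
([invariably_generatesP]); most generation arguments below therefore show that
a subgroup [M] with given properties is everything.

The heart is [wreath_set_invariable].  Let [t] in [Q] have infinite order, let
[X] generate [P] and let [T] invariably generate [Q].  Write [x] for the copy of
an element of [P] at the coordinate [1] of [wreath P Q].  Then the elements
[t], the elements of [T], the [x] and the products [x t], for [x] in [X],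
together invariably generate [wreath P Q].  Indeed, let [M] meet all their
classes.  Since [T] invariably generates [Q], [M] maps onto [Q], so the
conjugators may be taken in the base group; after conjugating [M] we may also
assume that [t] lies in [M].

Suppose now that [y^b] lies in [M], where [y = x t] and [b] is in the base.
Conjugation by [y] moves the coordinate [q] to [q t], and alters the entry only
at [q = 1], where it conjugates by [x].  As [b] has finite support and [t] has
infinite order, [b] is trivial at some [t^-k] and at some [t^m] with [k, m > 0].
Then [w = t^-k (y^b)^(k+m) t^-m] in [M] carries an entry at [1] out to [t^-k],
where [b] does not change it, through the coordinate [1], where it is
conjugated by [x], on to [t^m], where again [b] does not change it, and back
to [1] ([coordinate_normal]).  Hence the subgroup of those [p] in [P] whose
copy at [1] lies in [M] is normal in [P].  It contains a conjugate of
each [x] in [X], so it is [P]; as [M] maps onto [Q], [M] contains the whole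
base and is everything ([wreath_subgroupT]).

The generating set is finite when [X] and [T] are, which gives the FIG claims;
taking [X] to be all of [P] gives an invariable generating set when [P] is
infinitely generated.  That there is no finite one follows in two ways: a quotient of
an FIG group is FIG, and [wreath P Q] maps onto [Q]; and an FIG group is
finitely generated, while [wreath P Q] is finitely generated only if [P] is
([wreath_fg_base]).  To embed an arbitrary group in an IG group, multiply it first
by a direct sum of infinitely many copies of the integers: the product is not
finitely generated. *)

Set Implicit Arguments.
Unset Strict Implicit.
Unset Printing Implicit Defensive.

Local Open Scope classical_set_scope.
Local Open Scope group_scope.

(** * Subgroups and generation *)

Lemma subgroup1 (K : groupType) (M : set K) : is_subgroup M -> M 1.
Proof. by case. Qed.

Lemma subgroupV (K : groupType) (M : set K) x : is_subgroup M -> M x -> M x^-1.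
Proof. by move=> [M1 Mdiv] Mx; rewrite -div1g; apply: Mdiv. Qed.

Lemma subgroupM (K : groupType) (M : set K) x y :
  is_subgroup M -> M x -> M y -> M (x * y).
Proof.
move=> sM Mx My; rewrite -[y]invgK; apply: (proj2 sM) => //.
exact: subgroupV.
Qed.

Lemma subgroupX (K : groupType) (M : set K) x n :
  is_subgroup M -> M x -> M (x ^+ n).
Proof.
move=> sM Mx; elim: n => [|n IHn]; first by rewrite expg0; apply: subgroup1.
by rewrite expgS; apply: subgroupM.
Qed.

Lemma subgroupJ (K : groupType) (M : set K) x y :
  is_subgroup M -> M y -> M (x ^ y) <-> M x.
Proof.
have closed u v : is_subgroup M -> M v -> M u -> M (u ^ v).
  move=> sM Mv Mu; rewrite conjgE; apply: subgroupM => //.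
    exact: subgroupV.
  exact: subgroupM.
move=> sM My; split=> [Mxy|]; last exact: closed.
by rewrite -[x](conjgK y); apply: closed => //; apply: subgroupV.
Qed.

Lemma generatedTP (K : groupType) (S : set K) :
  generated S = setT <->
  forall M, is_subgroup M -> S `<=` M -> forall x, M x.
Proof.
split=> [genS M sM SM x|minS].
  suff genM : generated S `<=` M by apply: genM; rewrite genS.
  exact: smallest_sub.
by apply/seteqP; split=> // x _ M [sM SM]; apply: minS.
Qed.

(** The conjugators [a] in the definition can be chosen, by the axiom of choice,
so as to bring each [s] into [M]. *)
Lemma invariably_generatesP (K : groupType) (S : set K) :
  invariably_generates S <->
  forall M, is_subgroup M -> (forall s, S s -> exists a, M (s ^ a)) ->
  forall x, M x.
Proof.
split=> [invS M sM meetM|minS a].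
  have [a aP] : {a : K -> K & forall s, S s -> M (s ^ a s)}.
    apply: (choice (P := fun s b => S s -> M (s ^ b))) => s.
    have [/meetM[b Mb]|nSs] := pselect (S s); first by exists b.
    by exists 1.
  by apply: (proj1 (generatedTP _) (invS a)) => // _ [s /aP Ms <-].
apply/generatedTP => M sM SM; apply: minS => // s Ss.
by exists (a s); apply: SM; exists s.
Qed.

Lemma invariably_generates_generated (K : groupType) (S : set K) :
  invariably_generates S -> generated S = setT.
Proof.
move=> /invariably_generatesP minS; apply/generatedTP => M sM SM.
by apply: minS => // s Ss; exists 1; rewrite conjg1; apply: SM.
Qed.

Lemma is_subgroup_preimage (K L : groupType) (f : UMagmaMorphism.type K L)
    (M : set L) : is_subgroup M -> is_subgroup (f @^-1` M).
Proof.
move=> [M1 Mdiv]; split=> [|x y Mx My]; rewrite /preimage /=.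
  by rewrite gmulf1.
by rewrite gmulfF; apply: Mdiv.
Qed.

Lemma FIG_quotient (K L : groupType) (f : UMagmaMorphism.type K L) :
  (forall y, exists x, f x = y) -> FIG K -> FIG L.
Proof.
move=> fsurj [S [finS /invariably_generatesP minS]]; exists (f @` S).
split; first exact: finite_image.
apply/invariably_generatesP => M sM meetM y; have [x <-] := fsurj y.
apply: (minS _ (is_subgroup_preimage f sM)) => s Ss.
have [b Mb] := meetM (f s) (imageP _ Ss).
by have [a fa] := fsurj b; exists a; rewrite /preimage /= gmulfJ fa.
Qed.

Lemma FIG_fg (K : groupType) : FIG K -> finitely_generated K.
Proof.
move=> [S [finS invS]]; exists S; split=> //.
exact: invariably_generates_generated.
Qed.

Lemma fg_quotient (K L : groupType) (f : UMagmaMorphism.type K L) :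
  (forall y, exists x, f x = y) ->
  finitely_generated K -> finitely_generated L.
Proof.
move=> fsurj [S [finS /generatedTP minS]]; exists (f @` S).
split; first exact: finite_image.
apply/generatedTP => M sM SM y; have [x <-] := fsurj y.
apply: (minS _ (is_subgroup_preimage f sM)) => s Ss.
by apply: SM; exists s.
Qed.

(** * Direct products *)

Lemma subgroup_pairT (A B : groupType) (M : set (A * B)%type) :
  is_subgroup M -> (forall a, M (a, 1)) -> (forall b, M (1, b)) ->
  forall x, M x.
Proof.
move=> sM MA MB [a b]; have -> : (a, b) = (a, 1) * (1, b) :> (A * B)%type.
  by congr (_, _); rewrite /= ?mulg1 ?mul1g.
exact: subgroupM.
Qed.

Definition pair1r (A B : groupType) (a : A) : (A * B)%type := (a, 1).
Definition pair1l (A B : groupType) (b : B) : (A * B)%type := (1, b).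

Lemma pair1r_morph (A B : groupType) : monoid_morphism (@pair1r A B).
Proof. by split=> // a b; congr (_, _); rewrite /= mulg1. Qed.

Lemma pair1l_morph (A B : groupType) : monoid_morphism (@pair1l A B).
Proof. by split=> // a b; congr (_, _); rewrite /= mulg1. Qed.

HB.instance Definition _ (A B : groupType) :=
  isUMagmaMorphism.Build A (A * B)%type (@pair1r A B) (@pair1r_morph A B).
HB.instance Definition _ (A B : groupType) :=
  isUMagmaMorphism.Build B (A * B)%type (@pair1l A B) (@pair1l_morph A B).

Lemma fg_pair (A B : groupType) :
  finitely_generated A -> finitely_generated B ->
  finitely_generated (A * B)%type.
Proof.
move=> [X [finX /generatedTP minX]] [Y [finY /generatedTP minY]].
exists ((@pair1r A B @` X) `|` (@pair1l A B @` Y)); split.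
  by rewrite finite_setU; split; apply: finite_image.
apply/generatedTP => M sM SM; apply: subgroup_pairT => // [a|b].
  apply: (minX _ (is_subgroup_preimage (@pair1r A B) sM)) => x Xx.
  by apply: SM; left; exists x.
apply: (minY _ (is_subgroup_preimage (@pair1l A B) sM)) => y Yy.
by apply: SM; right; exists y.
Qed.

Lemma invariably_generates_pair (A B : groupType) (X : set A) (Y : set B) :
  invariably_generates X -> invariably_generates Y ->
  invariably_generates ((@pair1r A B @` X) `|` (@pair1l A B @` Y)).
Proof.
move=> /invariably_generatesP minX /invariably_generatesP minY.
apply/invariably_generatesP => M sM meetM.
apply: subgroup_pairT => // [a|b].
  apply: (minX _ (is_subgroup_preimage (@pair1r A B) sM)) => x Xx.
  have [|[c d]] := meetM (pair1r B x); first by left; exists x.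
  move=> Mcd; exists c; rewrite /preimage /= /pair1r.
  suff <- : (x, 1) ^ (c, d) = (x ^ c, 1) :> (A * B)%type by [].
  by congr (_, _); rewrite /= mul1g mulVg.
apply: (minY _ (is_subgroup_preimage (@pair1l A B) sM)) => y Yy.
have [|[c d]] := meetM (pair1l A y); first by right; exists y.
move=> Mcd; exists d; rewrite /preimage /= /pair1l.
suff <- : (1, y) ^ (c, d) = (1, y ^ d) :> (A * B)%type by [].
by congr (_, _); rewrite /= mul1g mulVg.
Qed.

(** * Elements of infinite order *)

Definition infinite_order (K : groupType) (t : K) : Prop :=
  forall n, (0 < n)%N -> t ^+ n <> 1.

Lemma nontorsion_infinite_order (K : groupType) :
  ~ torsion K -> exists t : K, infinite_order t.
Proof.
move=> /existsNP[t tP]; exists t => n n0 tn; apply: tP.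
by exists n.
Qed.

Lemma infinite_orderV (K : groupType) (t : K) :
  infinite_order t -> infinite_order t^-1.
Proof.
move=> ordt n n0; rewrite expVgn => /(congr1 monoid.inv).
by rewrite invgK invg1; apply: ordt.
Qed.

Lemma infinite_order_inj (K : groupType) (t : K) :
  infinite_order t -> injective (fun n => t ^+ n).
Proof.
move=> ordt; suff le i j : (i <= j)%N -> t ^+ i = t ^+ j -> i = j.
  move=> i j tij; have [ij|ji] := orP (leq_total i j); first exact: le.
  exact/esym/le.
rewrite leq_eqVlt => /orP[/eqP//|ij]; rewrite -(subnKC (ltnW ij)) expgnDr.
rewrite -[LHS]mulg1 => /mulgI/esym; case/ordt.
by rewrite subn_gt0.
Qed.

(** The powers of [t] are pairwise distinct and [f] has finite support. *)
Lemma dsum_infinite_order (Q P : groupType) (f : dsum Q P) (t : Q) :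
  infinite_order t -> exists2 n, (0 < n)%N & dsum_app f (t ^+ n) = 1.
Proof.
move=> ordt; apply: contrapT => noff.
pose s := [seq t ^+ n | n <- iota 1 (size (finsupp f)).+1].
suff : (size s <= size (finsupp f))%N by rewrite size_map size_iota ltnn.
apply: uniq_leq_size.
  by rewrite map_inj_uniq ?iota_uniq //; apply: infinite_order_inj.
move=> q /mapP[n]; rewrite mem_iota => /andP[n0 _] ->{q}.
rewrite mem_finsupp; apply/eqP => fn; apply: noff.
by exists n.
Qed.

(** * Subgroups of direct sums and wreath products *)

(** Induction on a list that covers the support. *)
Lemma dsum_subgroupT (Q P : groupType) (M : set (dsum Q P)) :
  is_subgroup M -> (forall q p, M (dsum_single q p)) -> forall f, M f.
Proof.
move=> sM Msingle f; suff onseq (s : seq Q) : forall g : dsum Q P,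
    (forall q, q \notin s -> dsum_app g q = 1) -> M g.
  by apply: (onseq (finsupp f)) => q; apply: fsfun_dflt.
elim: s => [|q s IHs] g gs.
  suff -> : g = 1 by apply: subgroup1.
  by apply: dsumP => q; rewrite gs // dsum_oneE.
pose h : dsum Q P := dsum_single q (dsum_app g q).
rewrite -[g](mulVKg h); apply: (subgroupM sM (Msingle _ _)).
apply: IHs => r rs; rewrite dsum_mulE dsum_invE dsum_singleE.
have [->|rq] := eqVneq r q; first by rewrite mulVg.
by rewrite invg1 mul1g gs // inE negb_or rq.
Qed.

Definition wsingle (P Q : groupType) (q : Q) (p : P) : wreath P Q :=
  Wreath (dsum_single q p) 1.

Definition wbase (P Q : groupType) (f : dsum Q P) : wreath P Q := Wreath f 1.

Definition wtop (P Q : groupType) (q : Q) : wreath P Q := Wreath 1 q.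

Lemma wr_top_morph (P Q : groupType) : monoid_morphism (@wr_top P Q).
Proof. by []. Qed.

HB.instance Definition _ (P Q : groupType) :=
  isUMagmaMorphism.Build (wreath P Q) Q (@wr_top P Q) (@wr_top_morph P Q).

Lemma wbase_morph (P Q : groupType) : monoid_morphism (@wbase P Q).
Proof.
by split=> // f g; rewrite /wbase wreath_mulE mulg1 invg1 dsum_shift1.
Qed.

HB.instance Definition _ (P Q : groupType) :=
  isUMagmaMorphism.Build (dsum Q P) (wreath P Q) (@wbase P Q)
    (@wbase_morph P Q).

Lemma wtop_morph (P Q : groupType) : monoid_morphism (@wtop P Q).
Proof. by split=> // q r; rewrite /wtop wreath_mulE dsum_shift_one mulg1. Qed.

HB.instance Definition _ (P Q : groupType) :=
  isUMagmaMorphism.Build Q (wreath P Q) (@wtop P Q) (@wtop_morph P Q).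

Lemma wsingle_morph (P Q : groupType) (q : Q) :
  monoid_morphism (@wsingle P Q q).
Proof.
split=> [|x y]; rewrite /wsingle.
  by congr Wreath; apply: dsumP => r; rewrite dsum_singleE dsum_oneE; case: ifP.
rewrite wreath_mulE mulg1 invg1 dsum_shift1; congr Wreath.
apply: dsumP => r; rewrite dsum_mulE !dsum_singleE.
by case: ifP => // _; rewrite mulg1.
Qed.

HB.instance Definition _ (P Q : groupType) (q : Q) :=
  isUMagmaMorphism.Build P (wreath P Q) (wsingle q) (@wsingle_morph P Q q).

Lemma wreath_split (P Q : groupType) (u : wreath P Q) :
  u = wbase (wr_base u) * wtop P (wr_top u).
Proof.
case: u => f h; rewrite /wbase /wtop wreath_mulE dsum_shift_one.
by rewrite mulg1 mul1g.
Qed.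

Lemma wreath_div_top (P Q : groupType) (u v : wreath P Q) :
  wr_top u = wr_top v -> u / v = wbase (wr_base (u / v)).
Proof.
by move=> uv; rewrite {1}[u / v]wreath_split gmulfF uv mulgV mulg1.
Qed.

Lemma wsingle_conj_base (P Q : groupType) (f : dsum Q P) (q : Q) (p : P) :
  wsingle q p ^ wbase f = wsingle q (p ^ dsum_app f q).
Proof.
rewrite /wsingle /wbase conjgE wreath_invE !wreath_mulE !(invg1, dsum_shift1).
rewrite !mulg1; congr Wreath; apply: dsumP => r.
rewrite !dsum_mulE dsum_invE !dsum_singleE conjgE.
by case: eqVneq => [->//|_]; rewrite mul1g mulVg.
Qed.

Lemma wsingle_conj (P Q : groupType) (u : wreath P Q) (q : Q) (p : P) :
  wsingle q p ^ u = wsingle (q * wr_top u) (p ^ dsum_app (wr_base u) q).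
Proof.
by rewrite {1}[u]wreath_split conjgM wsingle_conj_base wreath_conj.
Qed.

(** An element of [M] over [q] conjugates the copy of [P] at [1] onto the copy at
[q], so [M] contains the base, and [M] has an element in each of its cosets. *)
Lemma wreath_subgroupT (P Q : groupType) (M : set (wreath P Q)) :
  is_subgroup M -> (forall p, M (wsingle 1 p)) ->
  (forall q, exists2 u, M u & wr_top u = q) -> forall u, M u.
Proof.
move=> sM Msingle topM.
have Mbase f : M (wbase f).
  apply: (dsum_subgroupT (is_subgroup_preimage (@wbase P Q) sM)) => q p.
  have [u Mu uq] := topM q; set c := dsum_app (wr_base u) 1.
  suff : M (wsingle 1 (p ^ c^-1) ^ u) by rewrite wsingle_conj mul1g uq conjgKV.
  exact/subgroupJ.
move=> u; have [v Mv vu] := topM (wr_top u).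
rewrite -[u](mulgVK v); apply: subgroupM => //.
by rewrite wreath_div_top.
Qed.

Lemma wreath_fg (P Q : groupType) :
  finitely_generated P -> finitely_generated Q ->
  finitely_generated (wreath P Q).
Proof.
move=> [X [finX /generatedTP minX]] [Y [finY /generatedTP minY]].
exists ((@wsingle P Q 1 @` X) `|` (@wtop P Q @` Y)); split.
  by rewrite finite_setU; split; apply: finite_image.
apply/generatedTP => M sM SM; apply: wreath_subgroupT => // [p|q].
  apply: (minX _ (is_subgroup_preimage (@wsingle P Q 1) sM)) => x Xx.
  by apply: SM; left; exists x.
exists (wtop P q) => //.
apply: (minY _ (is_subgroup_preimage (@wtop P Q) sM)) => y Yy.
by apply: SM; right; exists y.
Qed.

(** The entries of finitely many elements of [wreath P Q] form a finite set, and
the elements whose entries all lie in a given subgroup of [P] form a subgroup. *)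
Lemma wreath_fg_base (P Q : groupType) :
  finitely_generated (wreath P Q) -> finitely_generated P.
Proof.
move=> [S [finS /generatedTP minS]].
pose X := \bigcup_(u in S)
  [set dsum_app (wr_base u) q | q in [set` finsupp (wr_base u)]].
exists X; split.
  by apply: bigcup_finite => // u _; apply: finite_image; apply: finite_fset.
apply/generatedTP => M sM XM p.
pose M' : set (wreath P Q) := [set u | forall q, M (dsum_app (wr_base u) q)].
have M'T : forall u, M' u.
  apply: (minS M') => [|u Su q].
    split=> [q|u v M'u M'v q]; first by rewrite dsum_oneE; apply: subgroup1.
    rewrite /= dsum_mulE !dsum_shiftE dsum_invE.
    by apply: (proj2 sM); [apply: M'u | apply: M'v].
  have [qf|qf] := boolP (q \in finsupp (wr_base u)).
    by apply: XM; exists u => //; exists q.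
  by rewrite /dsum_app fsfun_dflt //; apply: subgroup1.
by have := M'T (wsingle 1 p) 1; rewrite /= dsum_singleE eqxx.
Qed.

(** * Invariable generation of wreath products *)

(** Away from the coordinate [1], conjugation by [x t] merely translates. *)
Lemma wsingle_conj_shift (P Q : groupType) (t q : Q) (x p : P) n :
  let y : wreath P Q := Wreath (dsum_single 1 x) t in
  (forall i, (i < n)%N -> q * t ^+ i <> 1) ->
  wsingle q p ^ (y ^+ n) = wsingle (q * t ^+ n) p.
Proof.
move=> y; elim: n => [|n IHn] qt; first by rewrite !expg0 mulg1 conjg1.
rewrite expgSr conjgM IHn => [|i lt_in]; last by apply: qt; apply: ltnW.
rewrite wsingle_conj /= dsum_singleE (introF eqP (qt n (ltnSn n))) conjg1.
by rewrite expgSr mulgA.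
Qed.

(** Conjugation by a suitable [w] in [M] turns the copy of [p] at [1] into that of
[p ^ x]: it sends the coordinate [1] along
[1 -> t^-k -> ... -> 1 -> t -> ... -> t^(m+1) -> 1]. *)
Lemma coordinate_normal (P Q : groupType) (M : set (wreath P Q)) (t : Q)
    (x : P) (b : dsum Q P) :
  infinite_order t -> is_subgroup M -> M (wtop P t) ->
  M ((Wreath (dsum_single 1 x) t : wreath P Q) ^ wbase b) ->
  forall p, M (wsingle 1 (p ^ x)) <-> M (wsingle 1 p).
Proof.
set y : wreath P Q := Wreath _ t; move=> ordt sM Mt My p.
have yshift n q r : (forall i, (i < n)%N -> q * t ^+ i <> 1) ->
    wsingle q r ^ (y ^+ n) = wsingle (q * t ^+ n) r.
  exact: wsingle_conj_shift.
(* [b] is trivial at [t^-k] and at [t^(m+1)]. *)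
have [k k0 bk] := dsum_infinite_order b (infinite_orderV ordt).
have [[//|m] _ bm] := dsum_infinite_order b ordt.
have Mtop n : M (wtop P (t ^+ n)) by rewrite gmulfXn; apply: subgroupX.
pose w := wtop P (t ^- k) * (y ^+ (k + m.+1) ^ wbase b) * wtop P (t ^- m.+1).
have Mw : M w.
  rewrite /w conjXg !gmulfV; apply: (subgroupM sM (subgroupM sM _ _)).
  - exact: subgroupV sM (Mtop k).
  - exact: subgroupX.
  - exact: subgroupV sM (Mtop m.+1).
suff <- : wsingle 1 p ^ w = wsingle 1 (p ^ x) by apply: subgroupJ.
rewrite /w !conjgM wsingle_conj mul1g /= dsum_oneE conjg1.
have bfix n q : dsum_app b q = 1 -> wsingle q n ^ wbase b = wsingle q n.
  by rewrite wsingle_conj_base => ->; rewrite conjg1.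
rewrite -{1}[wsingle (t ^- k) p](bfix p) ?conjgK; last by rewrite -expVgn.
(* The first [k] steps stay at the coordinates [t^(i-k)] with [i < k]. *)
rewrite expgnDr expgS !conjgM yshift => [|i ik]; last first.
  move=> /(canRL (mulVKg _)); rewrite mulg1 => /(infinite_order_inj ordt) e.
  by rewrite e ltnn in ik.
(* The next step leaves the coordinate [1]: the entry is conjugated by [x]. *)
rewrite mulVg wsingle_conj /= dsum_singleE eqxx mul1g.
rewrite yshift => [|i _]; last by rewrite -expgS; apply: ordt.
by rewrite -expgS bfix // wsingle_conj /= mulgV dsum_oneE conjg1.
Qed.

(** [M] meets the coordinate [1] in a normal subgroup of [P], by
[coordinate_normal], so the conjugates of the [x] that it contains suffice. *)
Lemma wreath_subgroup_conjT (P Q : groupType) (t : Q) (X : set P)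
    (M : set (wreath P Q)) :
  infinite_order t -> generated X = setT -> is_subgroup M ->
  (forall q, exists2 u, M u & wr_top u = q) -> M (wtop P t) ->
  (forall x, X x -> exists b, M (wsingle 1 x ^ wbase b)) ->
  (forall x, X x -> exists b,
     M ((Wreath (dsum_single 1 x) t : wreath P Q) ^ wbase b)) ->
  forall u, M u.
Proof.
move=> ordt /generatedTP minX sM topM Mt meetx meetxt.
apply: wreath_subgroupT => //.
have normal g : forall p, M (wsingle 1 (p ^ g)) <-> M (wsingle 1 p).
  pose C : set P :=
    [set g | forall p, M (wsingle 1 (p ^ g)) <-> M (wsingle 1 p)].
  suff : C g by []; apply: (minX C) => [|x Xx]; last first.
    by have [b Mb] := meetxt x Xx => p; exact: (coordinate_normal ordt sM Mt Mb).
  split=> [p|c d Cc Cd p]; first by rewrite conjg1.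
  by rewrite conjgM -(Cd (_ ^ d^-1)) conjgKV; apply: Cc.
apply: (minX _ (is_subgroup_preimage (@wsingle P Q 1) sM)) => x Xx.
have [b] := meetx x Xx; rewrite wsingle_conj_base.
by case: (normal (dsum_app b 1) x).
Qed.

Definition wreath_set (P Q : groupType) (t : Q) (X : set P) (T : set Q)
    : set (wreath P Q) :=
  @wtop P Q @` (t |` T) `|` @wsingle P Q 1 @` X
    `|` (fun x => Wreath (dsum_single 1 x) t) @` X.

Lemma wreath_set_finite (P Q : groupType) (t : Q) (X : set P) (T : set Q) :
  finite_set X -> finite_set T -> finite_set (wreath_set t X T).
Proof.
move=> finX finT; rewrite /wreath_set !finite_setU; split; [split|].
- by apply: finite_image; rewrite finite_setU; split=> //; apply: finite_set1.
- exact: finite_image.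
- exact: finite_image.
Qed.

(** Reduction to [wreath_subgroup_conjT]: conjugators move into the base because
[M] maps onto [Q], and [M] is replaced by a conjugate that contains [t]. *)
Lemma wreath_set_invariable (P Q : groupType) (t : Q) (X : set P) (T : set Q) :
  infinite_order t -> generated X = setT -> invariably_generates T ->
  invariably_generates (wreath_set t X T).
Proof.
move=> ordt genX /invariably_generatesP minT.
apply/invariably_generatesP => M sM meetM.
have topM q : exists2 u, M u & wr_top u = q.
  pose M' : set Q := [set r | exists2 u, M u & wr_top u = r].
  suff : M' q by []; apply: (minT M') => [|s Ss].
    split; first by exists 1; first exact: subgroup1.
    move=> _ _ [u Mu <-] [v Mv <-]; exists (u / v); last by rewrite gmulfF.
    exact: (proj2 sM).
  have [|a Ma] := meetM (wtop P s); first by left; left; exists s => //; right.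
  by exists (wr_top a); exists (wtop P s ^ a) => //; rewrite gmulfJ.
(* If [m] in [M] has the image of [a] in [Q], then [a = (a / m) m]. *)
have meetb s : wreath_set t X T s -> exists b, M (s ^ wbase b).
  move=> /meetM[a Ma]; have [m Mm ma] := topM (wr_top a).
  exists (wr_base (a / m)).
  by rewrite -wreath_div_top // conjgM; apply/subgroupJ => //; apply: subgroupV.
have [|b Mb] := meetb (wtop P t); first by left; left; exists t => //; left.
pose M1 : set (wreath P Q) := [set u | M (u ^ wbase b)].
have sM1 : is_subgroup M1.
  split=> [|u v M1u M1v]; first by rewrite /M1 /= conj1g; apply: subgroup1.
  by rewrite /M1 /= conjMg conjVg; apply: (proj2 sM).
have meet1 s : wreath_set t X T s -> exists c, M1 (s ^ wbase c).
  move=> /meetb[c Mc]; exists (c / b).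
  by rewrite /M1 /= -conjgM -gmulfM mulgVK.
suff M1T : forall u, M1 u.
  by move=> u; rewrite -[u](conjgKV (wbase b)); apply: M1T.
apply: (wreath_subgroup_conjT ordt genX sM1) => // [q|x Xx|x Xx].
- have [u Mu uq] := topM q; exists (u ^ (wbase b)^-1).
    by rewrite /M1 /= conjgKV.
  by rewrite gmulfJ /= uq invg1 conjg1.
- by apply: meet1; left; right; exists x.
- by apply: meet1; right; exists x.
Qed.

Lemma FIG_wreath (P Q : groupType) (t : Q) :
  infinite_order t -> finitely_generated P -> FIG Q -> FIG (wreath P Q).
Proof.
move=> ordt [X [finX genX]] [T [finT invT]]; exists (wreath_set t X T).
by split; [apply: wreath_set_finite | apply: wreath_set_invariable].
Qed.

Lemma invariable_wreath (P Q : groupType) (t : Q) :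
  infinite_order t -> (exists T : set Q, invariably_generates T) ->
  exists S : set (wreath P Q), invariably_generates S.
Proof.
move=> ordt [T invT]; exists (wreath_set t setT T).
apply: wreath_set_invariable => //; apply/generatedTP => M _ TM x.
exact: TM.
Qed.

Lemma FIG_wreath_top (P Q : groupType) : FIG (wreath P Q) -> FIG Q.
Proof.
have surj (q : Q) : exists u : wreath P Q, wr_top u = q by exists (wtop P q).
exact: (FIG_quotient (f := @wr_top P Q) surj).
Qed.

(** * The infinite cyclic group *)

Definition infcyc_gen : infcyc := 1%R : int.

Lemma infcyc_invariable : invariably_generates [set infcyc_gen].
Proof.
apply/invariably_generatesP => M sM meetM x.
have M1 : M (1%R : int).
  have [a] := meetM _ erefl; congr M; rewrite conjgE.
  by rewrite (_ : _ * a = a * (1%R : int)) ?mulKg //; apply: GRing.addrC.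
suff Mn n : M (n%:Z%R : int).
  by case: x => n; [apply: Mn | apply: (subgroupV sM (Mn n.+1))].
elim: n => [|n IHn]; first exact: (subgroup1 sM).
by have := subgroupM sM M1 IHn; congr M; rewrite intS.
Qed.

Lemma infcyc_FIG : FIG infcyc.
Proof.
exists [set infcyc_gen]; split; first exact: finite_set1.
exact: infcyc_invariable.
Qed.

Lemma infcyc_infinite_order : infinite_order infcyc_gen.
Proof.
move=> n n0; suff -> : infcyc_gen ^+ n = (n%:Z : int) :> infcyc.
  by move=> /eqP; rewrite eqz_nat => /eqP n1; rewrite n1 in n0.
elim: {n0} n => [|n IHn]; first by rewrite expg0.
by rewrite expgS IHn intS.
Qed.

(** * Embeddings *)

Lemma embeds_trans (K L N : groupType) : embeds K L -> embeds L N -> embeds K N.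
Proof. by move=> [f f_inj] [g g_inj]; exists (g \o f); apply: inj_comp. Qed.

Lemma embeds_pair (A B : groupType) : embeds A (A * B)%type.
Proof. by exists (@pair1r A B) => a a' []. Qed.

Lemma embeds_wreath (P Q : groupType) : embeds P (wreath P Q).
Proof.
exists (@wsingle P Q 1) => x y /(congr1 (fun u => dsum_app (wr_base u) 1)).
by rewrite /= !dsum_singleE eqxx.
Qed.

(** Finitely many elements are all trivial at some common coordinate. *)
Lemma dsum_not_fg (P : groupType) :
  nontrivial P -> ~ finitely_generated (dsum nat P).
Proof.
move=> [p p1] [S [finS /generatedTP minS]].
pose D := \bigcup_(f in S) [set` finsupp f].
have finD : finite_set D by apply: bigcup_finite => // f _; apply: finite_fset.
have [n nD] : exists n, ~ D n.
  apply/existsNP => DT; apply: infinite_nat; apply: sub_finite_set finD => n _.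
  exact: DT.
pose M : set (dsum nat P) := [set f | dsum_app f n = 1].
have : M (dsum_single n p).
  apply: (minS M) => [|f Sf].
    split=> [|f g Mf Mg]; first exact: dsum_oneE.
    by rewrite /M /= dsum_mulE dsum_invE Mf Mg mulgV.
  by apply: fsfun_dflt; apply/negP => nf; apply: nD; exists f.
by rewrite /M /= dsum_singleE eqxx.
Qed.

(** * Groups that are IG *)

Lemma IG_wreath_infcyc (H : groupType) :
  ~ finitely_generated H -> IG (wreath H infcyc).
Proof.
move=> nfgH; split; last by move=> /FIG_fg/wreath_fg_base.
apply: (invariable_wreath _ infcyc_infinite_order).
by exists [set infcyc_gen]; apply: infcyc_invariable.
Qed.

Lemma IG_fg_wreath (G Q : groupType) (t : Q) :
  infinite_order t -> IG Q -> finitely_generated G -> finitely_generated Q ->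
  IG (wreath G Q) /\ finitely_generated (wreath G Q).
Proof.
move=> ordt [invQ nFIG] fgG fgQ; split; last exact: wreath_fg.
by split; [apply: (invariable_wreath _ ordt) | move=> /FIG_wreath_top].
Qed.

Lemma IG_pair_infcyc (A : groupType) : IG A -> IG (A * infcyc)%type.
Proof.
move=> [[T invT] nFIG]; split.
  by eexists; apply: (invariably_generates_pair invT infcyc_invariable).
move=> FIGA; apply: nFIG.
have surj (a : A) : exists x : (A * infcyc)%type, x.1 = a by exists (a, 1).
exact: (FIG_quotient (f := @fst A infcyc) surj).
Qed.

Lemma pair_infcyc_infinite_order (A : groupType) :
  infinite_order (pair1l A infcyc_gen).
Proof.
move=> n n0; rewrite -gmulfXn => /(congr1 snd).
exact: infcyc_infinite_order.
Qed.

Theorem corollaryA :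
  (forall G : groupType, nontrivial G -> finitely_generated G ->
     FIG (wreath G infcyc))
  /\
  (forall G A : groupType, nontrivial G -> finitely_generated G ->
     IG A -> finitely_generated A ->
     (IG (wreath G (A * infcyc)%type) /\
      finitely_generated (wreath G (A * infcyc)%type)) /\
     (~ torsion A -> IG (wreath G A) /\ finitely_generated (wreath G A)))
  /\
  (forall H : groupType, ~ finitely_generated H -> IG (wreath H infcyc))
  /\
  (forall G : groupType, finitely_generated G ->
     exists K : groupType, FIG K /\ embeds G K)
  /\
  (forall G : groupType, exists K : groupType, IG K /\ embeds G K)
  /\
  ((exists A : groupType, IG A /\ finitely_generated A) ->
   forall G : groupType, finitely_generated G ->
     exists K : groupType, (IG K /\ finitely_generated K) /\ embeds G K).
Proof.
have FIG_infcyc (G : groupType) :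
    finitely_generated G -> FIG (wreath G infcyc).
  by move=> fgG; apply: (FIG_wreath infcyc_infinite_order fgG infcyc_FIG).
have IG_fg_infcyc (G A : groupType) :
    finitely_generated G -> IG A -> finitely_generated A ->
    IG (wreath G (A * infcyc)%type) /\
    finitely_generated (wreath G (A * infcyc)%type).
  move=> fgG IGA fgA.
  apply: (IG_fg_wreath (@pair_infcyc_infinite_order A)) => //.
    exact: IG_pair_infcyc.
  exact: fg_pair fgA (FIG_fg infcyc_FIG).
split; first by move=> G _; apply: FIG_infcyc.
split.
  move=> G A _ fgG IGA fgA; split; first exact: IG_fg_infcyc.
  by move=> /nontorsion_infinite_order[t ordt]; apply: (IG_fg_wreath ordt).
split; first exact: IG_wreath_infcyc.
split.
  move=> G fgG; exists (wreath G infcyc).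
  by split; [apply: FIG_infcyc | apply: embeds_wreath].
split.
  move=> G; pose L : groupType := (G * dsum nat infcyc)%type.
  exists (wreath L infcyc); split.
    apply: IG_wreath_infcyc => fgL.
    have surj (f : dsum nat infcyc) : exists x : L, x.2 = f by exists (1, f).
    have : finitely_generated (dsum nat infcyc).
      exact: (fg_quotient (f := @snd G (dsum nat infcyc)) surj).
    by apply: dsum_not_fg; exists (1%R : int).
  exact: embeds_trans (embeds_pair _ _) (embeds_wreath _ _).
move=> [A [IGA fgA]] G fgG; exists (wreath G (A * infcyc)%type).
by split; [apply: IG_fg_infcyc | apply: embeds_wreath].
Qed.
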